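(* Let $(D,S,F)$ be a POA signature, let $\beta\colon B\to N$ be an nf-homomorphism of $(D\cup S,F)$-algebras and let $\Gamma$ be a $\beta$-coherent set of $(D,S,F)$-transitions. Then $(N,\stackrel{*}{\longrightarrow}_{\Gamma/\beta})$ is a preordered $(D,S,F)$-algebra and moreover $\beta\colon(B,\stackrel{*}{\longrightarrow}_{\Gamma/B})\to(N,\stackrel{*}{\longrightarrow}_{\Gamma/\beta})$ is a POA homomorphism.
   Context: POA signatures. A POA signature is a triple $(D,S,F)$ with $D\cap S=\emptyset$ and $(D\cup S,F)$ a many-sorted algebraic signature (operation symbols $\sigma\in F_{w\to s}$, with arity $w$ and sort $s$); elements of $D$ are data sorts, elements of $S$ are system sorts. Terms and variables are those of $(D\cup S,F)$. Atoms are equations $t=t'$ between terms of the same sort, and transitions $t\Rightarrow t'$ between terms of the same system sort. A $(D,S,F)$-transition is a Horn sentence $\forall X\, H\to (t\Rightarrow t')$, where $X$ is a set of variables, $H$ is a finite conjunction of atoms (equations and/or transitions), and the atoms are over $(D\cup S,F\cup X)$. $H_=$ is the set of equations and $H_\to$ the set of transitions in $H$, viewed as sets of pairs of terms. Preordered algebras. A preordered $(D,S,F)$-algebra $(A,\leqslant)$ is a $(D\cup S,F)$-algebra $A$ with a preorder $\leqslant_s$ on $A_s$ for each $s\in S$, such that $A_\sigma$ is monotone for each operation symbol $\sigma$ whose result sort is a system sort (arguments of data sorts being compared by equality). A POA homomorphism is a homomorphism of the underlying algebras that is monotone on system sorts. For a sort-respecting map $\theta\colon X\to A$ and a term $t$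 over $F\cup X$, $\theta t$ is the value of $t$ in $A$ under $\theta$. Algebraic rewriting. A context $c[z]$ is a term $c$ over $(D\cup S,F\cup\{z\})$, where $z$ is a new variable, such that either $c=z$, or $c=\sigma(c_1,\dots,c_n)$ with $\sigma$ an operation symbol of $F$ and exactly one $k\in\{1,\dots,n\}$ such that $c_k$ is a context, the other $c_i$ ($i\neq k$) being just $(D\cup S,F)$-terms. Let $B$ be a $(D\cup S,F)$-algebra. For a context $c[z]$ of sort $s'$ with $z$ of sort $s$, $B_c\colon B_s\to B_{s'}$ is the identity if $c=z$, and $B_c(b)=B_\sigma(B_{c_1},\dots,B_{c_k}(b),\dots,B_{c_n})$ if $c=\sigma(c_1,\dots,c_k[z],\dots,c_n)$. Let $\Delta_B=\{(b,b)\mid b\in B\}$ be the diagonal, and for a relation $\Omega\subseteq B\times B$ let $$\Gamma(\Omega)=\{(B_c(\theta t),B_c(\theta t'))\mid c[z]\text{ a context whose sort is a system sort, with } z \text{ of the sort of } t,t',\ (\forall X\,H\to(t\Rightarrow t'))\in\Gamma,\ \theta\colon X\to B,\ \theta H_=\subseteq\Delta_B,\ \theta H_\to\subseteq\Omega\}.$$ Put $\Gamma_{B,0}=\Delta_B$, $\Gamma_{B,k+1}=\Gamma_{B,k}^*\cup\Gamma(\Gamma_{B,k}^* )$, where $R^*$ is the reflexive-transitive closure of $R$. Define $b\longrightarrow_{\Gamma/B}b'$ iff $(b,b')\in\Gamma(\Gamma_{B,k}^* )$ for some $k\in\omega$, and let $\stackrel{*}{\longrightarrow}_{\Gamma/B}$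 be the reflexive-transitive closure of $\longrightarrow_{\Gamma/B}$ (on data sorts it is equality; in preordered algebras one uses its restriction to system sorts). Normal forms and coherence. A homomorphism $\beta\colon B\to N$ of $(D\cup S,F)$-algebras is an nf-homomorphism when $N\subseteq B$ (inclusion of carriers, sort by sort) and $\beta n=n$ for each $n\in N$. The relation $\longrightarrow_{\Gamma/\beta}$ on $N$ is: $n_1\longrightarrow_{\Gamma/\beta}n_2$ iff there is $b_2\in B$ with $n_1\longrightarrow_{\Gamma/B}b_2$ and $\beta b_2=n_2$; $\stackrel{*}{\longrightarrow}_{\Gamma/\beta}$ is its reflexive-transitive closure. $\Gamma$ is $\beta$-coherent when $b_1\longrightarrow_{\Gamma/B}b_2$ implies $\beta b_1\stackrel{*}{\longrightarrow}_{\Gamma/\beta}\beta b_2$.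
   Formalization: Side terms of contexts may use elements of B as constants (terms over F ∪ B) instead of being ground F-terms; with ground F-terms only, the claim fails when B has elements that are not values of ground terms. *)

(* Defs.v *)
From Stdlib Require Export List Relation_Operators RelationClasses.

Set Implicit Arguments.
Unset Strict Implicit.

(* [args C w] is the product C_{s1} * ... * C_{sn} for w = s1...sn. *)
Inductive args (I : Type) (C : I -> Type) : list I -> Type :=
| anil : args C nil
| acons : forall (s : I) (w : list I), C s -> args C w -> args C (s :: w).
Arguments anil {I C}.

Definition amap (I : Type) (C C' : I -> Type) (h : forall s, C s -> C' s) :
    forall w, args C w -> args C' w :=
  fix go w (a : args C w) : args C' w :=
    match a with
    | anil => anil
    | acons x a' => acons (h _ x) (go _ a')
    end.

Inductive args_rel (I : Type) (C : I -> Type) (R : forall s, C s -> C s -> Prop) :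
    forall w, args C w -> args C w -> Prop :=
| arel_nil : args_rel R anil anil
| arel_cons : forall s w (x y : C s) (a b : args C w),
    R s x y -> args_rel R a b -> args_rel R (acons x a) (acons y b).

(* The sorts of (D,S,F) are the elements of the sum type, so that data and
   system sorts are disjoint. Symbols may be overloaded: [op w s] is F_{w -> s}. *)
Record signature : Type := Signature {
  data_sort : Type;
  system_sort : Type;
  op : list (data_sort + system_sort) -> data_sort + system_sort -> Type
}.

Definition sort (Sg : signature) : Type := (data_sort Sg + system_sort Sg)%type.

Definition sys (Sg : signature) (s : system_sort Sg) : sort Sg := inr s.

Definition operations (Sg : signature) (C : sort Sg -> Type) : Type :=
  forall (w : list (sort Sg)) (s : sort Sg), op w s -> args C w -> C s.

Record algebra (Sg : signature) : Type := Algebra {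
  carrier :> sort Sg -> Type;
  apply : operations carrier
}.

Definition homomorphism (Sg : signature) (A B : algebra Sg)
    (h : forall s, A s -> B s) : Prop :=
  forall (w : list (sort Sg)) (s : sort Sg) (f : op w s) (a : args A w),
    h s (apply f a) = apply f (amap h a).

Inductive term (Sg : signature) (X : sort Sg -> Type) : sort Sg -> Type :=
| Var : forall s, X s -> term X s
| App : forall w s, op w s -> args (term X) w -> term X s.

Fixpoint eval (Sg : signature) (A : algebra Sg) (X : sort Sg -> Type)
    (theta : forall s, X s -> A s) (s : sort Sg) (t : term X s) : A s :=
  match t with
  | Var x => theta _ x
  | App f ts => apply f (amap (fun s' (t' : term X s') => eval theta t') ts)
  end.

Inductive atom (Sg : signature) (X : sort Sg -> Type) : Type :=
| Equation : forall s : sort Sg, term X s -> term X s -> atom X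
| Transition : forall s : system_sort Sg, term X (sys s) -> term X (sys s) -> atom X.

(* The Horn sentence  forall X, H -> (t => t'). *)
Record transition (Sg : signature) : Type := HornTransition {
  vars : sort Sg -> Type;
  hyps : list (atom vars);
  tsort : system_sort Sg;
  lhs : term vars (sys tsort);
  rhs : term vars (sys tsort)
}.

(* [context Y s s'] : contexts c[z] of sort s' with z of sort s, whose side terms
   are over F + Y; [context_args Y s w] : tuples of which exactly one component
   is a context, the others being terms. *)
Inductive context (Sg : signature) (Y : sort Sg -> Type) (s : sort Sg) :
    sort Sg -> Type :=
| Hole : context Y s s
| CApp : forall w s', op w s' -> context_args Y s w -> context Y s s'
with context_args (Sg : signature) (Y : sort Sg -> Type) (s : sort Sg) :
    list (sort Sg) -> Type :=
| CHere : forall s1 w, context Y s s1 -> args (term Y) w -> context_args Y s (s1 :: w)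
| CThere : forall s1 w, term Y s1 -> context_args Y s w -> context_args Y s (s1 :: w).
Arguments Hole {Sg Y s}.

Fixpoint eval_context (Sg : signature) (A : algebra Sg) (Y : sort Sg -> Type)
    (eta : forall s, Y s -> A s) (s s' : sort Sg) (c : context Y s s') (b : A s) :
    A s' :=
  match c in context _ _ s0 return A s0 with
  | Hole => b
  | CApp f cs => apply f (eval_context_args eta cs b)
  end
with eval_context_args (Sg : signature) (A : algebra Sg) (Y : sort Sg -> Type)
    (eta : forall s, Y s -> A s) (s : sort Sg) (w : list (sort Sg))
    (cs : context_args Y s w) (b : A s) : args A w :=
  match cs in context_args _ _ w0 return args A w0 with
  | CHere c ts => acons (eval_context eta c b) (amap (fun s' (t : term Y s') => eval eta t) ts)
  | CThere t cs' => acons (eval eta t) (eval_context_args eta cs' b)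
  end.

(* A context of B may use the elements of B as constants, that is, its side terms
   are (D + S, F + B)-terms. With ground F-terms only, the rewriting relation
   would not be preserved by the operations when B has elements that are not
   values of ground terms. *)
Definition bcontext (Sg : signature) (B : algebra Sg) (s s' : sort Sg) : Type :=
  context B s s'.

Definition apply_context (Sg : signature) (B : algebra Sg) (s s' : sort Sg)
    (c : bcontext B s s') (b : B s) : B s' :=
  eval_context (fun _ x => x) c b.

Definition srel (Sg : signature) (C : sort Sg -> Type) : Type :=
  forall s : sort Sg, C s -> C s -> Prop.

Definition star (Sg : signature) (C : sort Sg -> Type) (R : srel C) : srel C :=
  fun s => clos_refl_trans (C s) (R s).

(* Gamma(Omega) *)
Inductive step (Sg : signature) (B : algebra Sg) (Gamma : transition Sg -> Prop)
    (Omega : srel B) : srel B :=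
| Step : forall (tr : transition Sg) (theta : forall s, vars tr s -> B s)
    (s' : system_sort Sg) (c : bcontext B (sys (tsort tr)) (sys s')),
    Gamma tr ->
    (forall s (t t' : term (vars tr) s),
        In (Equation t t') (hyps tr) -> eval theta t = eval theta t') ->
    (forall s (t t' : term (vars tr) (sys s)),
        In (Transition t t') (hyps tr) -> Omega (sys s) (eval theta t) (eval theta t')) ->
    step Gamma Omega
      (apply_context c (eval theta (lhs tr))) (apply_context c (eval theta (rhs tr))).

(* Gamma_{B,k} *)
Fixpoint level (Sg : signature) (B : algebra Sg) (Gamma : transition Sg -> Prop)
    (k : nat) : srel B :=
  match k with
  | O => fun s b b' => b = b'
  | S k' => fun s b b' =>
      star (level Gamma k') b b' \/ step Gamma (star (level Gamma k')) b b'
  end.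

Definition rewrites (Sg : signature) (B : algebra Sg) (Gamma : transition Sg -> Prop) :
    srel B :=
  fun s b b' => exists k : nat, step Gamma (star (level Gamma k)) b b'.

(* Algebras N with N_s a subset of B_s for each sort s; the operations of N are
   arbitrary, N need not be a subalgebra of B. *)
Record algebra_in (Sg : signature) (B : algebra Sg) : Type := AlgebraIn {
  in_carrier : forall s, B s -> Prop;
  in_op : operations (fun s => {b : B s | in_carrier b})
}.

Coercion algebra_of (Sg : signature) (B : algebra Sg) (N : algebra_in B) : algebra Sg :=
  Algebra (@in_op Sg B N).

Definition incl (Sg : signature) (B : algebra Sg) (N : algebra_in B) (s : sort Sg)
    (n : N s) : B s := proj1_sig n.

Record nf_homomorphism (Sg : signature) (B : algebra Sg) (N : algebra_in B)
    (beta : forall s, B s -> N s) : Prop := {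
  nf_hom : homomorphism beta;
  nf_fix : forall s (n : N s), beta s (incl n) = n
}.

Definition nf_rewrites (Sg : signature) (B : algebra Sg) (N : algebra_in B)
    (Gamma : transition Sg -> Prop) (beta : forall s, B s -> N s) : srel N :=
  fun s n1 n2 => exists b2 : B s, rewrites Gamma (incl n1) b2 /\ beta s b2 = n2.

Definition coherent (Sg : signature) (B : algebra Sg) (N : algebra_in B)
    (beta : forall s, B s -> N s) (Gamma : transition Sg -> Prop) : Prop :=
  forall s (b1 b2 : B s), rewrites Gamma b1 b2 ->
    star (nf_rewrites Gamma beta) (beta s b1) (beta s b2).

(* A family of relations on the system sorts only. *)
Definition system_rel (Sg : signature) (C : sort Sg -> Type) : Type :=
  forall s : system_sort Sg, C (sys s) -> C (sys s) -> Prop.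

Definition on_system (Sg : signature) (C : sort Sg -> Type) (R : srel C) :
    system_rel C :=
  fun s => R (sys s).

Definition extend_eq (Sg : signature) (C : sort Sg -> Type) (le : system_rel C) :
    srel C :=
  fun s => match s with
           | inl d => fun x y => x = y
           | inr s' => le s'
           end.

Record preordered_algebra (Sg : signature) (A : algebra Sg) (le : system_rel A) :
    Prop := {
  poa_preorder : forall s, PreOrder (le s);
  poa_monotone : forall w (s : system_sort Sg) (f : op w (sys s)) (a a' : args A w),
    args_rel (extend_eq le) a a' -> le s (apply f a) (apply f a')
}.

Record poa_homomorphism (Sg : signature) (A : algebra Sg) (leA : system_rel A)
    (B : algebra Sg) (leB : system_rel B) (h : forall s, A s -> B s) : Prop := {
  poa_hom_source : preordered_algebra leA;
  poa_hom_target : preordered_algebra leB;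
  poa_hom_hom : homomorphism h;
  poa_hom_monotone : forall s (a a' : A (sys s)), leA s a a' -> leB s (h _ a) (h _ a')
}.

(* Main.v *)
Require Import Defs.

Set Implicit Arguments.
Unset Strict Implicit.

(** Monotonicity of an operation in all its arguments at once follows from
    monotonicity in one argument at a time: a star step in every argument is a
    finite chain of changes of a single argument by a single step, and the star
    relation composes the resulting chain ([star_preordered_algebra]).

    In [B], changing one argument of [f(a1,...,an)] by a rewriting step is again a
    rewriting step. The step in the argument is a redex inside a context [c], and
    [f(a1,...,c,...,an)] is a context because elements of [B] may serve as constants
    ([step_apply]). Hence the star of rewriting makes [B] a preordered algebra.

    In [N], let [n'] arise from the arguments [n] by one step of rewriting modulo
    [beta]. Such a step rewrites in [B] and then applies [beta], so [n'] is the image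
    under [beta] of some [b] obtained from [n] by a step in one argument in [B].
    The result for [B] gives [B_f(n) --> B_f(b)], and coherence takes this to a
    star step from [beta (B_f(n))] to [beta (B_f(b))]. As [beta] is a homomorphism
    that fixes [N], these two elements are [N_f(n)] and [N_f(n')]. That [beta] is
    monotone is coherence again, along a chain. *)

(** * Changing one argument at a time *)

Inductive arg_step (I : Type) (C : I -> Type) (R : forall s, C s -> C s -> Prop) :
    forall w, args C w -> args C w -> Prop :=
| arg_step_here : forall s w (x y : C s) (a : args C w),
    R s x y -> arg_step R (acons x a) (acons y a)
| arg_step_there : forall s w (x : C s) (a b : args C w),
    arg_step R a b -> arg_step R (acons x a) (acons x b).

Definition arg_star (I : Type) (C : I -> Type) (R : forall s, C s -> C s -> Prop)
    (w : list I) : args C w -> args C w -> Prop :=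
  clos_refl_trans (args C w) (@arg_step I C R w).

Lemma arg_star_here (Sg : signature) (C : sort Sg -> Type) (R : srel C) s w
    (x y : C s) (a : args C w) :
  star R x y -> arg_star R (acons x a) (acons y a).
Proof.
  intros H; induction H as [x y H | x | x y z _ IH1 _ IH2].
  - apply rt_step, arg_step_here, H.
  - apply rt_refl.
  - exact (rt_trans _ _ _ _ _ IH1 IH2).
Qed.

Lemma arg_star_there (I : Type) (C : I -> Type) (R : forall s, C s -> C s -> Prop)
    s w (x : C s) (a b : args C w) :
  arg_star R a b -> arg_star R (acons x a) (acons x b).
Proof.
  intros H; induction H as [a b H | a | a b c _ IH1 _ IH2].
  - apply rt_step, arg_step_there, H.
  - apply rt_refl.
  - exact (rt_trans _ _ _ _ _ IH1 IH2).
Qed.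

(** The arguments can be moved from left to right, one after the other, since
    arguments of data sorts do not move at all. *)
Lemma args_rel_arg_star (Sg : signature) (C : sort Sg -> Type) (R : srel C) w
    (a a' : args C w) :
  args_rel (extend_eq (on_system (star R))) a a' -> arg_star R a a'.
Proof.
  intros H; induction H as [| s w x y a b Hxy _ IH].
  - apply rt_refl.
  - apply rt_trans with (acons y a).
    + destruct s as [d | s]; simpl in Hxy.
      * rewrite Hxy; apply rt_refl.
      * apply arg_star_here, Hxy.
    + apply arg_star_there, IH.
Qed.

Lemma star_preordered_algebra (Sg : signature) (A : algebra Sg) (R : srel A) :
  (forall w (s : system_sort Sg) (f : op w (sys s)) (a a' : args A w),
      arg_step R a a' -> star R (apply f a) (apply f a')) ->
  preordered_algebra (on_system (star R)).
Proof.
  intros HR; split.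
  - intros s; split.
    + intros x; apply rt_refl.
    + intros x y z; apply rt_trans.
  - intros w s f a a' H; apply args_rel_arg_star in H.
    induction H as [a a' H | a | a b c _ IH1 _ IH2].
    + apply HR, H.
    + apply rt_refl.
    + exact (rt_trans _ _ _ _ _ IH1 IH2).
Qed.

(** * Rewriting in B *)

Lemma eval_constants (Sg : signature) (B : algebra Sg) w (a : args B w) :
  amap (fun s (t : term B s) => eval (fun _ x => x) t)
    (amap (fun s (x : B s) => Var x) a) = a.
Proof.
  induction a as [| s w x a IH]; simpl.
  - reflexivity.
  - f_equal; exact IH.
Qed.

(** The context of a step in one argument is extended to a tuple with exactly one
    context, by taking the other arguments as constants. The tuple is kept apart
    from the operation because the induction is on the tuple of arguments. *)
Lemma arg_step_context (Sg : signature) (B : algebra Sg)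
    (Gamma : transition Sg -> Prop) (Omega : srel B) w (a a' : args B w) :
  arg_step (step Gamma Omega) a a' ->
  exists (tr : transition Sg) (theta : forall s, vars tr s -> B s)
    (cs : context_args B (sys (tsort tr)) w),
    Gamma tr /\
    (forall s (t t' : term (vars tr) s),
        In (Equation t t') (hyps tr) -> eval theta t = eval theta t') /\
    (forall s (t t' : term (vars tr) (sys s)),
        In (Transition t t') (hyps tr) ->
        Omega (sys s) (eval theta t) (eval theta t')) /\
    a = eval_context_args (fun _ x => x) cs (eval theta (lhs tr)) /\
    a' = eval_context_args (fun _ x => x) cs (eval theta (rhs tr)).
Proof.
  intros H; induction H as [s w x y a H | s w x a b _ IH].
  - destruct H as [tr theta s c HG Heq Htr].
    exists tr, theta, (CHere c (amap (fun s (x : B s) => Var x) a)).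
    simpl; rewrite eval_constants; repeat split; assumption.
  - destruct IH as (tr & theta & cs & HG & Heq & Htr & -> & ->).
    exists tr, theta, (CThere (Var x) cs); repeat split; assumption.
Qed.

Lemma step_apply (Sg : signature) (B : algebra Sg) (Gamma : transition Sg -> Prop)
    (Omega : srel B) w (s : system_sort Sg) (f : op w (sys s)) (a a' : args B w) :
  arg_step (step Gamma Omega) a a' -> step Gamma Omega (apply f a) (apply f a').
Proof.
  intros H; apply arg_step_context in H.
  destruct H as (tr & theta & cs & HG & Heq & Htr & -> & ->).
  exact (Step (CApp f cs) HG Heq Htr).
Qed.

Lemma rewrites_apply (Sg : signature) (B : algebra Sg)
    (Gamma : transition Sg -> Prop) w (s : system_sort Sg) (f : op w (sys s))
    (a a' : args B w) :
  arg_step (rewrites Gamma) a a' -> rewrites Gamma (apply f a) (apply f a').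
Proof.
  intros H.
  (* Only one argument moves, so a single level [k] serves for the whole tuple. *)
  assert (Hk : exists k, arg_step (step Gamma (star (level Gamma k))) a a').
  { clear f; induction H as [s' w x y a [k H] | s' w x a b _ [k IH]]; exists k.
    - apply arg_step_here, H.
    - apply arg_step_there, IH. }
  destruct Hk as [k Hk]; exists k; apply step_apply, Hk.
Qed.

(** * Rewriting modulo an nf-homomorphism *)

Lemma amap_beta_incl (Sg : signature) (B : algebra Sg) (N : algebra_in B)
    (beta : forall s : sort Sg, B s -> N s) :
  nf_homomorphism beta ->
  forall w (n : args N w), amap beta (amap (@incl Sg B N) n) = n.
Proof.
  intros Hbeta w n; induction n as [| s w x n IH].
  - reflexivity.
  - exact (f_equal2 (@acons _ N s w) (nf_fix Hbeta x) IH).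
Qed.

Lemma arg_step_lift (Sg : signature) (B : algebra Sg) (N : algebra_in B)
    (beta : forall s : sort Sg, B s -> N s) (Gamma : transition Sg -> Prop) :
  nf_homomorphism beta ->
  forall w (n n' : args N w), arg_step (nf_rewrites Gamma beta) n n' ->
  exists b : args B w,
    arg_step (rewrites Gamma) (amap (@incl Sg B N) n) b /\ amap beta b = n'.
Proof.
  intros Hbeta w n n' H.
  induction H as [s w x y n (b & Hb & <-) | s w x n n' _ (b & Hb & <-)].
  - exists (acons b (amap (@incl Sg B N) n)); split.
    + apply arg_step_here, Hb.
    + simpl; f_equal; apply (amap_beta_incl Hbeta).
  - exists (acons (incl x) b); split.
    + apply arg_step_there, Hb.
    + simpl; f_equal; apply (nf_fix Hbeta).
Qed.

(** The operations of [N] need not be restrictions of those of [B]; they are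
    recovered from them as [N_f(n) = beta (B_f(n))]. *)
Lemma nf_rewrites_apply (Sg : signature) (B : algebra Sg) (N : algebra_in B)
    (beta : forall s : sort Sg, B s -> N s) (Gamma : transition Sg -> Prop) :
  nf_homomorphism beta -> coherent beta Gamma ->
  forall w (s : system_sort Sg) (f : op w (sys s)) (n n' : args N w),
    arg_step (nf_rewrites Gamma beta) n n' ->
    star (nf_rewrites Gamma beta) (apply f n) (apply f n').
Proof.
  intros Hbeta HGamma w s f n n' H.
  destruct (arg_step_lift Hbeta H) as (b & Hb & <-).
  rewrite <- (amap_beta_incl Hbeta n) at 1.
  rewrite <- !(nf_hom Hbeta).
  apply HGamma, rewrites_apply, Hb.
Qed.

Lemma beta_star (Sg : signature) (B : algebra Sg) (N : algebra_in B)
    (beta : forall s : sort Sg, B s -> N s) (Gamma : transition Sg -> Prop) :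
  coherent beta Gamma ->
  forall s (b b' : B s), star (@rewrites Sg B Gamma) b b' ->
    star (nf_rewrites Gamma beta) (beta s b) (beta s b').
Proof.
  intros HGamma s b b' H; induction H as [b b' H | b | b1 b2 b3 _ IH1 _ IH2].
  - apply HGamma, H.
  - apply rt_refl.
  - exact (rt_trans _ _ _ _ _ IH1 IH2).
Qed.

Theorem proposition5p1 (Sg : signature) (B : algebra Sg) (N : algebra_in B)
    (beta : forall s : sort Sg, B s -> N s) (Gamma : transition Sg -> Prop)
    (Hbeta : nf_homomorphism beta) (HGamma : coherent beta Gamma) :
  preordered_algebra (on_system (star (nf_rewrites Gamma beta))) /\
  poa_homomorphism (on_system (star (@rewrites Sg B Gamma)))
    (on_system (star (nf_rewrites Gamma beta))) beta.
Proof.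
  assert (HN : preordered_algebra (on_system (star (nf_rewrites Gamma beta))))
    by exact (star_preordered_algebra (nf_rewrites_apply Hbeta HGamma)).
  split; [exact HN | split].
  - apply star_preordered_algebra.
    intros w s f a a' H; apply rt_step, rewrites_apply, H.
  - exact HN.
  - exact (nf_hom Hbeta).
  - intros s b b'; apply (beta_star HGamma).
Qed.
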